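(* Let $H=(V,E)$ be a hypergraph, $w\in \mathbb{R}_{\geq 0}^E$, $b\in \mathbb{Z}^V_{\geq 1}$, and let $x\in[0,1]^E$ be a fractional $b$-matching. Then the greedy algorithm (which orders the edges as $e_1,\dots,e_m$ with $w(e_1)\ge w(e_2)\ge\cdots\ge w(e_m)$, starts with $M=\emptyset$, and for $j=1,\dots,m$ adds $e_j$ to $M$ whenever $M\cup\{e_j\}$ is a $b$-matching) returns a $b$-matching $M$ satisfying \[ \sum_{e\in M}\bigl(|e|-(|e|-1)x(e)\bigr)w(e) \;\geq\; \sum_{e\in E} w(e)x(e). \]
   Context: A hypergraph $H=(V,E)$ has a finite vertex set $V$ and edge set $E\subseteq 2^V$. For $v\in V$, $\delta(v)=\{e\in E: v\in e\}$, and for $x\in\mathbb{R}^E$ and $U\subseteq E$, $x(U)=\sum_{e\in U}x(e)$. Given vertex capacities $b\in\mathbb{Z}^V_{\ge 1}$, a $b$-matching is a set $M\subseteq E$ such that each $v\in V$ is contained in at most $b(v)$ edges of $M$. A fractional $b$-matching is a vector $x\in[0,1]^E$ with $x(\delta(v))\le b(v)$ for all $v\in V$. Ties in the weight ordering may be broken arbitrarily. *)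

(* Defs.v *)
From mathcomp Require Import all_boot all_order all_algebra.
From mathcomp Require Import reals.
Set Implicit Arguments.
Unset Strict Implicit.
Unset Printing Implicit Defensive.
Import Order.TTheory GRing.Theory Num.Theory.
Local Open Scope ring_scope.

(* A hypergraph on the finite vertex type V is given by its edge set
   E : {set {set V}}.  The empty set is allowed as an edge.
   Vectors indexed by E are total functions {set V} -> R, of which only the
   values on E are ever constrained or used. *)

Section Hypergraph.
Variables (V : finType) (E : {set {set V}}).

Definition star (U : {set {set V}}) (v : V) : {set {set V}} :=
  [set e in U | v \in e].

Definition is_bmatching (b : V -> nat) (M : {set {set V}}) : bool :=
  (M \subset E) && [forall v, (#|star M v| <= b v)%N].

Definition is_fractional_bmatching (R : realType) (b : V -> nat)
    (x : {set V} -> R) : Prop :=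
  (forall e, e \in E -> 0 <= x e <= 1) /\
  (forall v, \sum_(e in star E v) x e <= (b v)%:R).

(* Every tie-breaking rule yields some such s, and conversely. *)
Definition is_greedy_order (R : realType) (w : {set V} -> R)
    (s : seq {set V}) : Prop :=
  perm_eq s (enum E) /\ sorted (fun e f => w f <= w e) s.

Definition greedy_step (b : V -> nat) (M : {set {set V}}) (e : {set V}) :=
  if is_bmatching b (e |: M) then e |: M else M.

Definition greedy (b : V -> nat) (s : seq {set V}) : {set {set V}} :=
  foldl (greedy_step b) set0 s.

End Hypergraph.

(* Main.v *)
Require Import Defs.
From mathcomp Require Import all_boot all_order all_algebra.
From mathcomp Require Import reals.
Import Order.TTheory GRing.Theory Num.Theory.
Local Open Scope ring_scope.

Set Implicit Arguments.
Unset Strict Implicit.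

(** An edge [f] rejected by the greedy algorithm contains a vertex [v] that is
    saturated by edges of [M] at least as heavy as [f]; say that [v] blocks [f].
    After moving [x e * w e] for [e] in [M] to the other side, the claim reads
    [\sum_(e in M) #|e| (1 - x e) w e >= \sum_(f in E :\: M) w f x f], and the
    left-hand side is a sum over vertices [v] of [(1 - x e) w e] for the edges
    [e] of [M] at [v].  At each [v] this local sum pays for the edges blocked
    by [v]: the slacks [1 - x e] add up to [b v - x (star M v)], which by the
    constraint at [v] is at least the [x]-mass of the blocked edges, and these
    are no heavier than the edges of [M] at [v]. *)

Lemma starS (V : finType) (A B : {set {set V}}) (v : V) :
  A \subset B -> star A v \subset star B v.
Proof.
by move=> /subsetP AB; apply/subsetP => e; rewrite !inE => /andP[/AB -> ->].
Qed.

Section GreedyRun.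
Variables (V : finType) (E : {set {set V}}) (b : V -> nat).
Implicit Types (s : seq {set V}) (M : {set {set V}}).

Lemma is_bmatching_set0 : is_bmatching E b set0.
Proof.
rewrite /is_bmatching sub0set; apply/forallP => v.
by rewrite (_ : star set0 v = set0) ?cards0 //; apply/setP => e; rewrite !inE.
Qed.

Lemma is_bmatching_foldl s M :
  is_bmatching E b M -> is_bmatching E b (foldl (greedy_step E b) M s).
Proof.
elim: s M => //= e s IHs M bM; apply: IHs.
by rewrite /greedy_step; case: ifP.
Qed.

Lemma foldl_greedy_step_sub s M : M \subset foldl (greedy_step E b) M s.
Proof.
elim: s M => //= e s IHs M; apply: subset_trans (IHs _).
by rewrite /greedy_step; case: ifP => // _; apply: subsetUr.
Qed.

Lemma mem_foldl_greedy_step s M e :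
  e \in foldl (greedy_step E b) M s -> (e \in M) || (e \in s).
Proof.
elim: s M => /= [M ->//|f s IHs M /IHs]; rewrite inE /greedy_step.
by case: ifP => _; rewrite ?inE; case: (e == f); case: (e \in M) => //= ->.
Qed.

(** Adding [e] violates the bound at some [v]. This forces [v \in e], since otherwise the star at
    [v] would not change, and as [e] adds at most one edge there, the bound was already tight. *)
Lemma rejected_edge_saturated M e :
  e \in E -> is_bmatching E b M -> ~~ is_bmatching E b (e |: M) ->
  exists2 v, v \in e & #|star M v| = b v.
Proof.
move=> eE /andP[ME /forallP bM].
rewrite /is_bmatching subUset sub1set eE ME /= negb_forall.
case/existsP=> v; rewrite -ltnNge => gt_b; exists v.
  apply: contraLR gt_b => ve; rewrite -leqNgt; apply: leq_trans (bM v).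
  apply/subset_leq_card/subsetP => f; rewrite !inE => /andP[/orP[/eqP->|->]//].
  by rewrite (negPf ve).
apply/eqP; rewrite eqn_leq bM -ltnS; apply: leq_trans gt_b _.
have -> : #|star M v|.+1 = (1 + #|star M v|)%N by [].
rewrite -(cards1 e); apply: leq_trans (leq_card_setU [set e] (star M v)).
apply/subset_leq_card/subsetP => f; rewrite !inE.
by case: (f == e) => //= /andP[-> ->].
Qed.

End GreedyRun.

(** Cut [s] at [f]: a vertex saturated when [f] is examined receives no later edge, so all its edges
    in the final matching precede [f] in [s]. *)
Lemma greedy_rejected_blocked (R : realType) (V : finType) (E : {set {set V}})
    (w : {set V} -> R) (b : V -> nat) (s : seq {set V}) (f : {set V}) :
  is_greedy_order E w s -> f \in E -> f \notin greedy E b s ->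
  exists v, [/\ v \in f, #|star (greedy E b s) v| = b v
    & forall e, e \in star (greedy E b s) v -> w f <= w e].
Proof.
move=> [s_perm s_sorted] fE fM.
have fs : f \in s by rewrite (perm_mem s_perm) mem_enum.
case/splitPr: fs s_sorted fM => s1 s2 s_sorted.
have bM : is_bmatching E b (greedy E b (s1 ++ f :: s2)).
  exact/is_bmatching_foldl/is_bmatching_set0.
set M1 := foldl (greedy_step E b) set0 s1.
have bM1 : is_bmatching E b M1.
  exact/is_bmatching_foldl/is_bmatching_set0.
have defM : greedy E b (s1 ++ f :: s2) =
    foldl (greedy_step E b) (greedy_step E b M1 f) s2.
  by rewrite /greedy foldl_cat.
have stepM : greedy_step E b M1 f \subset greedy E b (s1 ++ f :: s2).
  by rewrite defM foldl_greedy_step_sub.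
move=> fM; have rej : ~~ is_bmatching E b (f |: M1).
  apply: contra fM => acc; apply: (subsetP stepM).
  by rewrite /greedy_step acc !inE eqxx.
have [v vf satv] := rejected_edge_saturated fE bM1 rej.
have M1M : M1 \subset greedy E b (s1 ++ f :: s2).
  by move: stepM; rewrite /greedy_step (negPf rej).
(* The star at [v] can only grow from [M1] on, but it already has [b v] edges, the most that the
   final matching allows. *)
have starM : star M1 v = star (greedy E b (s1 ++ f :: s2)) v.
  apply/eqP; rewrite eqEcard starS //= satv.
  by case/andP: bM => _ /forallP.
exists v; split=> //; first by rewrite -starM.
move=> e; rewrite -starM inE => /andP[/mem_foldl_greedy_step].
rewrite inE /= => es1 _.
have w_trans : transitive (fun e f => w f <= w e).
  by move=> x y z xy /le_trans; apply.
move: s_sorted; rewrite (sorted_pairwise w_trans) pairwise_cat.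
by case/andP=> /allrelP /(_ e f es1); rewrite mem_head => ->.
Qed.

(** Double counting of incidences: [F e] appears once for each vertex of [e]. *)
Lemma sum_incidence (R : pzSemiRingType) (V : finType) (M : {set {set V}})
    (F : {set V} -> R) :
  \sum_v \sum_(e in star M v) F e = \sum_(e in M) #|e|%:R * F e.
Proof.
under eq_bigr => v _.
  by rewrite (eq_bigl (fun e => (e \in M) && (v \in e))) ?big_mkcondr;
     [over | move=> e; rewrite inE].
rewrite exchange_big; apply: eq_bigr => e _ /=.
by rewrite -big_mkcond /= sumr_const mulr_natl.
Qed.

(** Here [B] stands for the edges blocked by [v]. Saturation is conditional on a member of [B]
    because a vertex that blocks nothing may be unsaturated; its left-hand sum is then empty. *)
Lemma saturated_vertex_pays (R : realType) (V : finType)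
    (E M B : {set {set V}}) (w : {set V} -> R) (b : V -> nat)
    (x : {set V} -> R) (v : V) :
  (forall e, e \in E -> 0 <= w e) -> is_fractional_bmatching E b x ->
  M \subset E -> B \subset star (E :\: M) v ->
  (forall f, f \in B -> #|star M v| = b v) ->
  (forall e f, f \in B -> e \in star M v -> w f <= w e) ->
  \sum_(f in B) w f * x f <= \sum_(e in star M v) (1 - x e) * w e.
Proof.
move=> w_ge0 [x01 xb] ME BS sat heavy.
have starE e : e \in star M v -> e \in E.
  by rewrite inE => /andP[/(subsetP ME)].
have BE f : f \in B -> f \in E.
  by move/(subsetP BS); rewrite !inE => /andP[/andP[]].
have [->|[f0 f0B]] := set_0Vmem B.
  rewrite big_set0; apply: sumr_ge0 => e /starE eE.
  by rewrite mulr_ge0 ?w_ge0 // subr_ge0; case/andP: (x01 e eE).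
(* The weight [w g] separates the weights in [B] from those in [star M v], which reduces the claim
   to the unweighted inequality [mass]. *)
case: (arg_maxP w f0B) => g gB gmax.
have mass : \sum_(f in B) x f <= \sum_(e in star M v) (1 - x e).
  rewrite sumrB sumr_const (sat _ f0B) lerBrDl.
  apply: le_trans (xb v).
  rewrite [leRHS](big_setID (star M v)) /=.
  have -> : star E v :&: star M v = star M v by apply/setIidPr/starS.
  rewrite lerD2l [leRHS](big_setID B) /=.
  have -> : (star E v :\: star M v) :&: B = B.
    apply/setIidPr; apply: subset_trans BS _; apply/subsetP => e.
    by rewrite !inE => /andP[/andP[/negPf-> ->] ->].
  rewrite lerDl; apply: sumr_ge0 => e; rewrite !inE.
  by case/and3P=> _ _ /andP[eE _]; case/andP: (x01 e eE).
apply: (@le_trans _ _ (\sum_(f in B) w g * x f)).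
  apply: ler_sum => f fB; apply: ler_wpM2r; last exact: gmax.
  by case/andP: (x01 f (BE f fB)).
rewrite -mulr_sumr.
apply: le_trans (ler_wpM2l (w_ge0 _ (BE g gB)) mass) _.
rewrite mulr_sumr; apply: ler_sum => e eM; rewrite mulrC.
apply: ler_wpM2l; last exact: heavy.
by rewrite subr_ge0; case/andP: (x01 e (starE e eM)).
Qed.

Unset Implicit Arguments.
Set Strict Implicit.

Theorem theorem2 (R : realType) (V : finType) (E : {set {set V}})
    (w : {set V} -> R) (b : V -> nat) (x : {set V} -> R) (s : seq {set V})
    (w_ge0 : forall e, e \in E -> 0 <= w e)
    (b_ge1 : forall v, (1 <= b v)%N)
    (x_frac : is_fractional_bmatching E b x)
    (s_order : is_greedy_order E w s) :
  is_bmatching E b (greedy E b s) /\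
  \sum_(e in greedy E b s) (#|e|%:R - (#|e|%:R - 1) * x e) * w e
    >= \sum_(e in E) w e * x e.
Proof.
have bM : is_bmatching E b (greedy E b s).
  exact/is_bmatching_foldl/is_bmatching_set0.
split=> //; have blocked f := @greedy_rejected_blocked R V E w b s f s_order.
(* From here [M] is any subset of [E] such that each edge of [E] outside it is blocked by some
   vertex. *)
move: (greedy E b s) bM blocked => M /andP[ME _] blocked.
pose B v := [set f in star (E :\: M) v | (#|star M v| == b v) &&
                          [forall (e | e \in star M v), w f <= w e]].
have pays : \sum_v \sum_(f in B v) w f * x f <=
            \sum_(e in M) #|e|%:R * ((1 - x e) * w e).
  rewrite -(sum_incidence M (fun e => (1 - x e) * w e)).
  apply: ler_sum => v _.
  apply: (saturated_vertex_pays w_ge0 x_frac ME).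
  - by apply/subsetP => f; rewrite inE => /andP[].
  - by move=> f; rewrite inE => /and3P[_ /eqP].
  - by move=> e f; rewrite inE => /and3P[_ _ /forall_inP]; apply.
have wx_ge0 f : f \in E -> 0 <= w f * x f.
  by move=> fE; rewrite mulr_ge0 ?w_ge0 //; case/andP: (x_frac.1 f fE).
(* An edge may be blocked by several vertices and then counts repeatedly on the right; as the terms
   are nonnegative, no choice of a blocker is needed. *)
have covered : \sum_(f in E :\: M) w f * x f <=
               \sum_v \sum_(f in B v) w f * x f.
  have -> : \sum_v \sum_(f in B v) w f * x f =
            \sum_(f in E :\: M) \sum_(v | f \in B v) w f * x f.
    rewrite (exchange_big_dep (mem (E :\: M))) //= => v f _.
    by rewrite !inE => /andP[/andP[]].
  apply: ler_sum => f; rewrite inE => /andP[fM fE].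
  have [v [vf satv heavy]] := blocked f fE fM.
  have fB : f \in B v.
    by rewrite !inE fM fE vf satv eqxx; apply/forall_inP.
  by rewrite (bigD1 v) //= lerDl sumr_ge0 // => u _; apply: wx_ge0.
rewrite (big_setID M) (setIidPr ME) /=.
apply: le_trans (lerD (lexx _) (le_trans covered pays)) _.
(* Both sides agree edge by edge, by [x + c * (1 - x) = c - (c - 1) * x] with [c] the edge size. The
   subtraction is in [R], so this also covers the empty edge. *)
rewrite -big_split /= le_eqVlt; apply/orP; left; apply/eqP.
apply: eq_bigr => e _; move: (#|e|%:R : R) => c.
rewrite mulrA -(mulrC (x e)) -mulrDl; congr (_ * _).
by rewrite mulrBr mulr1 mulrBl mul1r opprB addrCA.
Qed.
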